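(* Let $p$ be a prime and let $G=D_{2p^2}$. Then $\mathcal{B}(G)$ is hypoenergetic, and it is not hyperenergetic, not L-hyperenergetic, not Q-hyperenergetic and not CN-hyperenergetic.
   Context: $D_{2m}=\langle a,b : a^m=b^2=1,\ bab=a^{-1}\rangle$ is the dihedral group of order $2m$. For a finite group $G$, let $L(G)$ be the set of all subgroups of $G$. The subgroup generating bipartite graph $\mathcal{B}(G)$ is the simple bipartite graph with vertex set the disjoint union of $G\times G$ and $L(G)$, in which $(a,b)\in G\times G$ and $H\in L(G)$ are adjacent if and only if $H$ is the subgroup generated by $a$ and $b$ (and there are no other edges). For a finite simple graph $\Gamma$ with $n$ vertices $v_1,\dots,v_n$ and $m$ edges, let $A$ be its adjacency matrix, $D$ its diagonal degree matrix, and $CN(\Gamma)$ the common neighborhood matrix, whose $(i,j)$ entry for $i\neq j$ is the number of vertices other than $v_i,v_j$ adjacent to both $v_i$ and $v_j$, with zero diagonal. The energy $E(\Gamma)$ and the common neighborhood energy $E_{CN}(\Gamma)$ are the sums of absolute values of the eigenvalues (with multiplicity) of $A$ and $CN(\Gamma)$ respectively. The Laplacian energy is $LE(\Gamma)=\sum_{\lambda}|\lambda-\frac{2m}{n}|$ over the eigenvalues $\lambda$ of $D-A$, and the signless Laplacian energy is $LE^+(\Gamma)=\sum_{\mu}|\mu-\frac{2m}{n}|$ over the eigenvalues $\mu$ of $D+A$ (both counted with multiplicity). With $K_n$ the complete graph on $n=|V(\Gamma)|$ vertices, $\Gamma$ is called hypoenergetic if $E(\Gamma)<n$; hyperenergetic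 if $E(\Gamma)>E(K_n)$; L-hyperenergetic if $LE(\Gamma)>LE(K_n)$; Q-hyperenergetic if $LE^+(\Gamma)>LE^+(K_n)$; CN-hyperenergetic if $E_{CN}(\Gamma)>E_{CN}(K_n)$. Here $E(K_n)=LE(K_n)=LE^+(K_n)=2(n-1)$ and $E_{CN}(K_n)=2(n-1)(n-2)$. *)

(* Defs.v *)
From HB Require Import structures.
From mathcomp Require Import all_boot all_order all_algebra.
From mathcomp Require Import all_fingroup all_solvable all_field.

Set Implicit Arguments.
Unset Strict Implicit.
Unset Printing Implicit Defensive.

Import Order.TTheory GRing.Theory Num.Theory.
Local Open Scope ring_scope.

Record sgraph := SGraph {
  vertex :> finType;
  adj : rel vertex;
  adj_sym : symmetric adj;
  adj_irr : irreflexive adj }.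

Lemma complete_sym n : symmetric (fun i j : 'I_n => i != j).
Proof. by move=> i j; rewrite eq_sym. Qed.

Lemma complete_irr n : irreflexive (fun i j : 'I_n => i != j).
Proof. by move=> i; rewrite eqxx. Qed.

Definition complete_graph (n : nat) : sgraph :=
  SGraph (@complete_sym n) (@complete_irr n).

Section Matrices.

Variable Gamma : sgraph.

Definition degree (x : Gamma) : nat := #|[set y | adj x y]|.

Definition edges : {set {set Gamma}} :=
  [set e | [exists x, exists y, adj x y && (e == [set x; y])]].

Definition common_nbrs (x y : Gamma) : {set Gamma} :=
  [set z | [&& z != x, z != y, adj z x & adj z y]].

(* Vertices are numbered by enum_val.  The matrices have natural number
   entries and are symmetric, so their eigenvalues are real algebraic numbers
   and nothing is lost by working in algC; its partial order is the usual
   one on the real elements, in particular on sums of norms. *)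
Definition adj_mx : 'M[algC]_#|Gamma| :=
  \matrix_(i, j) (adj (enum_val i) (enum_val j))%:R.

Definition degree_mx : 'M[algC]_#|Gamma| :=
  diag_mx (\row_i (degree (enum_val i))%:R).

Definition cn_mx : 'M[algC]_#|Gamma| :=
  \matrix_(i, j)
    if i == j then 0 else #|common_nbrs (enum_val i) (enum_val j)|%:R.

Definition average_degree : algC := (2 * #|edges|)%N%:R / #|Gamma|%:R.

End Matrices.

(* Roots of the characteristic polynomial, repeated according to their
   multiplicity; see eigenvaluesP. *)
Definition eigenvalues n (A : 'M[algC]_n) : seq algC :=
  sval (closed_field_poly_normal (char_poly A)).

Lemma eigenvaluesP n (A : 'M[algC]_n) :
  char_poly A = \prod_(z <- eigenvalues A) ('X - z%:P).
Proof.
rewrite /eigenvalues; case: closed_field_poly_normal => r /= {1}->.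
by rewrite (monicP (char_poly_monic A)) scale1r.
Qed.

Definition energy (Gamma : sgraph) : algC :=
  \sum_(z <- eigenvalues (adj_mx Gamma)) `|z|.

Definition cn_energy (Gamma : sgraph) : algC :=
  \sum_(z <- eigenvalues (cn_mx Gamma)) `|z|.

Definition laplacian_energy (Gamma : sgraph) : algC :=
  \sum_(z <- eigenvalues (degree_mx Gamma - adj_mx Gamma))
    `|z - average_degree Gamma|.

Definition signless_laplacian_energy (Gamma : sgraph) : algC :=
  \sum_(z <- eigenvalues (degree_mx Gamma + adj_mx Gamma))
    `|z - average_degree Gamma|.

Definition hypoenergetic (Gamma : sgraph) : Prop :=
  energy Gamma < #|Gamma|%:R.

Definition hyperenergetic (Gamma : sgraph) : Prop :=
  energy Gamma > energy (complete_graph #|Gamma|).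

Definition L_hyperenergetic (Gamma : sgraph) : Prop :=
  laplacian_energy Gamma > laplacian_energy (complete_graph #|Gamma|).

Definition Q_hyperenergetic (Gamma : sgraph) : Prop :=
  signless_laplacian_energy Gamma >
  signless_laplacian_energy (complete_graph #|Gamma|).

Definition CN_hyperenergetic (Gamma : sgraph) : Prop :=
  cn_energy Gamma > cn_energy (complete_graph #|Gamma|).

Section SubgroupGeneratingGraph.

Variable gT : finGroupType.

Definition sgb_vertex : finType := ((gT * gT) + {group gT})%type.

Definition sgb_adj (u v : sgb_vertex) : bool :=
  match u, v with
  | inl (a, b), inr H | inr H, inl (a, b) => <<[set a; b]>>%g == H :> {set gT}
  | _, _ => false
  end.

Lemma sgb_adj_sym : symmetric sgb_adj.
Proof. by case=> [[a b]|H] [[c d]|K]. Qed.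

Lemma sgb_adj_irr : irreflexive sgb_adj.
Proof. by case=> [[a b]|H]. Qed.

Definition subgroup_generating_graph : sgraph :=
  SGraph sgb_adj_sym sgb_adj_irr.

End SubgroupGeneratingGraph.

(* Main.v *)
Require Import Defs.
From mathcomp Require Import all_boot all_order all_algebra.
From mathcomp Require Import all_fingroup all_solvable all_field.
From mathcomp Require Import ring zify.

(** The graph B(G) is a disjoint union of stars.  A pair (a, b) has exactly one
    neighbour, the subgroup it generates, so the component of a subgroup H is a
    star with centre H and d(H) leaves, where d(H) is the number of pairs that
    generate H.  Put m = |G|^2, L = the number of subgroups, n = m + L; then
    the d(H) add up to m, which is also the number of edges.  All five claims
    follow from this and from |G| > 1, hence L >= 2.

    All spectra come from one identity.  Let B be the m x L incidence matrix of
    pairs and subgroups.  Its columns are orthogonal: B^T B is the diagonal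
    matrix of the d(H).  A Schur complement ([det_block_scalar]) then gives
    the characteristic polynomial of every block matrix
    [[a I, c B], [c B^T, diag e]] with c = 1 or -1 ([char_poly_star]).  This
    covers A, D - A and D + A, while CN is B B^T - I on the pairs and 0 on the
    subgroups.  The extra powers of a linear factor that these identities carry
    are additional eigenvalues on both sides; they cancel when |z - s| is summed
    over the eigenvalues z ([sum_eigenvalues_quadratic]).  The outcome is as follows.

    - E = sum_H 2 sqrt(d(H)).  As 2 sqrt(d) <= d + 1 with equality only for
      d = 1, E <= sum_H (d(H) + 1) = n.  The inequality is strict because, for
      distinct a and b, (a, b) and (b, a) generate the same subgroup, so that
      some d(H) is at least 2.  Since n <= 2 (n - 1), the graph is not
      hyperenergetic either.
    - D - A and D + A have the same spectrum: apart from the eigenvalue 1, each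
      subgroup contributes 0 and d(H) + 1.  With mean degree t = 2m/n and
      |d + 1 - t| <= d + |1 - t|, both energies are at most
      m |1 - t| + L t + m, which is 2m if L <= m and at most n otherwise.
      Neither exceeds 2 (n - 1).
    - E_CN <= 2 m, because each subgroup contributes |d(H) - 1| <= d(H) + 1 and
      the m - L eigenvalues -1 account for the rest.  This is at most
      2 (n - 1) (n - 2).

    The energies of the complete graph K_n are computed from the same
    determinant identity, all its matrices being of the form c I + t J with J
    the all-ones matrix of rank one. *)

Set Implicit Arguments.
Unset Strict Implicit.
Unset Printing Implicit Defensive.

Import Order.TTheory GRing.Theory Num.Theory.

Section Spectra.
Local Open Scope ring_scope.

(** * Determinants of block matrices and renumbering of vertices *)

(** A Schur complement without division: the factor y ^+ k is the price of
    clearing the upper right block by column operations when y need not be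
    invertible, as for y = 'X - a. *)
Lemma det_block_scalar (R : comNzRingType) m k (y : R) (B : 'M_(m, k))
    (C : 'M_(k, m)) (E : 'M_k) :
  \det (block_mx y%:M B C E) * y ^+ k = y ^+ m * \det (y *: E - C *m B).
Proof.
have -> : y ^+ k = \det (block_mx 1%:M (- B) 0 y%:M : 'M_(m + k)).
  by rewrite det_ublock det1 mul1r det_scalar.
rewrite -det_mulmx mulmx_block !mulmx1 !mulmx0 !addr0 !mulmxN.
rewrite mul_scalar_mx !mul_mx_scalar addNr det_lblock det_scalar.
by rewrite addrC.
Qed.

(** Sylvester's identity: up to powers of y, the characteristic polynomials of
    B C and C B agree, so the large matrix B B^T can be traded for B^T B. *)
Lemma det_scalar_sub_mulC (R : comNzRingType) m k (y : R) (B : 'M_(m, k))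
    (C : 'M_(k, m)) :
  \det (y%:M - B *m C) * y ^+ k = y ^+ m * \det (y%:M - C *m B).
Proof.
rewrite -[in RHS]scalemx1 -det_block_scalar; congr (_ * _).
have det1U : \det (block_mx 1%:M 0 (- C) 1%:M : 'M_(m + k)) = 1.
  by rewrite det_lblock !det1 mulr1.
rewrite -[RHS]mulr1 -[X in _ = _ * X]det1U -det_mulmx mulmx_block.
rewrite !mulmx1 !mulmx0 !add0r mulmxN mul1mx subrr.
by rewrite det_ublock det1 mulr1.
Qed.

Lemma char_poly_mxsub (R : comNzRingType) n m (h : 'I_n -> 'I_m) (A : 'M[R]_m) :
  bijective h -> char_poly (mxsub h h A) = char_poly A.
Proof.
move=> bij_h; have := bij_eq_card bij_h; rewrite !card_ord => eq_nm.
case: _ / eq_nm in A h bij_h *.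
pose s := perm (bij_inj bij_h).
rewrite /char_poly.
have -> : char_poly_mx (mxsub h h A) = row_perm s (col_perm s (char_poly_mx A)).
  by apply/matrixP=> i j; rewrite !mxE !permE (inj_eq (bij_inj bij_h)).
rewrite row_permE col_permE !det_mulmx !det_perm mulrCA -signr_addb.
by rewrite odd_permV addbb mulr1.
Qed.

(** The vertices of a disjoint union are numbered by [enum_val] in an order
    that need not put one side first; renumbering them exposes the blocks. *)
Lemma char_poly_sum_type (R : comNzRingType) (S T : finType)
    (F : S + T -> S + T -> R) :
  char_poly (\matrix_(i, j < #|{: S + T}|) F (enum_val i) (enum_val j)) =
  char_poly (block_mx
    (\matrix_(i < #|S|, j < #|S|) F (inl (enum_val i)) (inl (enum_val j)))
    (\matrix_(i < #|S|, j < #|T|) F (inl (enum_val i)) (inr (enum_val j)))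
    (\matrix_(i < #|T|, j < #|S|) F (inr (enum_val i)) (inl (enum_val j)))
    (\matrix_(i < #|T|, j < #|T|) F (inr (enum_val i)) (inr (enum_val j)))).
Proof.
pose g (k : 'I_(#|S| + #|T|)) : S + T :=
  match split k with inl i => inl (enum_val i) | inr j => inr (enum_val j) end.
have bij_h : bijective (enum_rank \o g).
  apply: bij_comp; first exact: enum_rank_bij.
  exists (fun v => match v with
    inl s => lshift _ (enum_rank s) | inr t => rshift _ (enum_rank t) end).
    by move=> k; rewrite /g; case: split_ordP => i ->; rewrite enum_valK.
  case=> [s|t]; rewrite /g; case: split_ordP => i /eqP;
    rewrite (eq_lshift, eq_rshift, eq_lrshift, eq_rlshift) // => /eqP <-;
    by rewrite enum_rankK.
rewrite -(char_poly_mxsub _ bij_h); congr char_poly.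
apply/matrixP=> i j; rewrite !mxE /= !enum_rankK /g.
by case: (split i) => i'; rewrite !mxE; case: (split j) => j'; rewrite !mxE.
Qed.

(** * Sums over spectra *)

Lemma sum_nseq (R : nmodType) (I : Type) l (c : I) (F : I -> R) :
  \sum_(z <- nseq l c) F z = F c *+ l.
Proof. by rewrite big_nseq -Monoid.iteropE. Qed.

Lemma prod_nseq (R : pzRingType) (I : Type) l (c : I) (F : I -> R) :
  \prod_(z <- nseq l c) F z = F c ^+ l.
Proof. by rewrite big_nseq -Monoid.iteropE. Qed.

(** Unique factorisation recovers the multiset of eigenvalues from a product
    identity, even when both sides carry additional linear factors. *)
Lemma sum_eigenvalues n (A : 'M[algC]_n) (s t : seq algC) (F : algC -> algC) :
  char_poly A * \prod_(z <- s) ('X - z%:P) = \prod_(z <- t) ('X - z%:P) ->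
  \sum_(z <- eigenvalues A) F z + \sum_(z <- s) F z = \sum_(z <- t) F z.
Proof.
rewrite eigenvaluesP -!big_cat /= => /prod_XsubC_eq eq_st.
exact: perm_big.
Qed.

(** The shape in which the spectra of star forests arise: every centre
    contributes two eigenvalues, and a root c is in excess on both sides. *)
Lemma sum_eigenvalues_quadratic n (A : 'M[algC]_n) (T : finType) (k m : nat)
    (c : algC) (r1 r2 : T -> algC) (F : algC -> algC) :
  char_poly A * ('X - c%:P) ^+ k =
    ('X - c%:P) ^+ m * \prod_t (('X - (r1 t)%:P) * ('X - (r2 t)%:P)) ->
  \sum_(z <- eigenvalues A) F z + F c *+ k =
    F c *+ m + \sum_t (F (r1 t) + F (r2 t)).
Proof.
move=> charA.
rewrite -!sum_nseq.
rewrite (@sum_eigenvalues _ _ _ (nseq m c ++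
  [seq r1 t | t <- index_enum T] ++ [seq r2 t | t <- index_enum T])).
  by rewrite !big_cat !big_map big_split.
by rewrite prod_nseq charA !big_cat !big_map prod_nseq big_split.
Qed.

(** * Incidence matrices of maps, and forests of stars *)

Section Star.
Variables (S T : finType) (f : S -> T).

Definition fibre_card (t : T) : nat := #|[set s | f s == t]|.

Definition incidence_mx (R : pzRingType) : 'M[R]_(#|S|, #|T|) :=
  \matrix_(i, j) (f (enum_val i) == enum_val j)%:R.

(** Columns of the incidence matrix are indicators of disjoint fibres. *)
Lemma incidence_gram (R : pzRingType) :
  (incidence_mx R)^T *m incidence_mx R =
  diag_mx (\row_j (fibre_card (enum_val j))%:R).
Proof.
apply/matrixP=> i j; rewrite !mxE.
under eq_bigr do rewrite !mxE -natrM mulnb.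
rewrite -natr_sum -(reindex _ (onW_bij _ (enum_val_bij S)) (P := predT)
  (F := fun s => ((f s == enum_val i) && (f s == enum_val j)) : nat)) /=.
case: eqVneq => [->|neq_ij] /=; rewrite ?mulr1n ?mulr0n.
  under eq_bigr do rewrite andbb.
  by rewrite -big_mkcond /fibre_card -sum1dep_card.
rewrite big1 // => s _; case: eqP => //= ->.
by rewrite (inj_eq enum_val_inj) (negPf neq_ij).
Qed.

Lemma incidence_mul_tr (R : pzRingType) i j :
  (incidence_mx R *m (incidence_mx R)^T) i j =
  (f (enum_val i) == f (enum_val j))%:R.
Proof.
rewrite !mxE (bigD1 (enum_rank (f (enum_val i)))) //= !mxE enum_rankK.
rewrite eqxx mul1r eq_sym big1 ?addr0 // => k neq_k; rewrite !mxE.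
case: eqP => [eq_k|_]; last by rewrite mul0r.
by rewrite eq_k enum_valK eqxx in neq_k.
Qed.

Lemma sum_fibre_card : (\sum_t fibre_card t = #|S|)%N.
Proof.
rewrite -sum1_card (partition_big f predT) //=.
by apply: eq_bigr => t _; rewrite /fibre_card -sum1dep_card.
Qed.

(** The graph joining each s to f s is a forest of stars.  With
    (a, c, e) = (0, 1, 0), (1, -1, fibre sizes) and (1, 1, fibre sizes) this is
    the characteristic polynomial of its adjacency, Laplacian and signless
    Laplacian matrix; only c ^+ 2 enters the result, which is why the last two
    have the same spectrum. *)
Lemma char_poly_star (R : comNzRingType) (F : S + T -> S + T -> R) (a c : R)
    (e : T -> R) :
    (forall s s', F (inl s) (inl s') = a *+ (s == s')) ->
    (forall s t, F (inl s) (inr t) = c *+ (f s == t)) ->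
    (forall t s, F (inr t) (inl s) = c *+ (f s == t)) ->
    (forall t t', F (inr t) (inr t') = e t *+ (t == t')) ->
    c ^+ 2 = 1 ->
  char_poly (\matrix_(i, j < #|{: S + T}|) F (enum_val i) (enum_val j)) *
    ('X - a%:P) ^+ #|T| =
  ('X - a%:P) ^+ #|S| *
    \prod_t (('X - a%:P) * ('X - (e t)%:P) - (fibre_card t)%:R).
Proof.
move=> Fss Fst Fts Ftt c2; rewrite char_poly_sum_type /char_poly.
set B := - c%:P *: incidence_mx {poly R}.
pose E : 'M[{poly R}]_#|T| := diag_mx (\row_j ('X - (e (enum_val j))%:P)).
set M := char_poly_mx _.
have -> : M = block_mx ('X - a%:P)%:M B B^T E.
  rewrite /M /char_poly_mx map_block_mx scalar_mx_block opp_block_mx.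
  rewrite add_block_mx !add0r; congr block_mx;
    apply/matrixP=> i j; rewrite !mxE.
  - rewrite Fss (inj_eq enum_val_inj); case: eqP => _;
      by rewrite ?mulr1n ?mulr0n ?polyC0 ?subr0.
  - rewrite Fst; case: eqP => _; by rewrite ?mulr1n ?mulr0n ?polyC0; ring.
  - rewrite Fts; case: eqP => _; by rewrite ?mulr1n ?mulr0n ?polyC0; ring.
  - rewrite Ftt (inj_eq enum_val_inj); case: eqVneq => [->|_];
      by rewrite ?mulr1n ?mulr0n ?polyC0 ?subr0.
rewrite det_block_scalar; congr (_ * _).
have -> : B^T *m B = (incidence_mx {poly R})^T *m incidence_mx {poly R}.
  have -> : B^T = - c%:P *: (incidence_mx {poly R})^T.
    by apply/matrixP=> i j; rewrite !mxE.
  by rewrite -scalemxAl -scalemxAr scalerA mulrNN -polyCM -expr2 c2 scale1r.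
rewrite incidence_gram /E -linearZ -linearB /= det_diag.
rewrite [RHS](reindex _ (onW_bij _ (enum_val_bij T))) /=.
by apply: eq_bigr => i _; rewrite !mxE.
Qed.

End Star.
End Spectra.

(** * Energies of complete graphs *)

Section Complete.
Local Open Scope ring_scope.

(** The all-ones matrix is the product of a column and a row, so Sylvester's
    identity reduces the characteristic polynomial to a determinant of size 1.
    The summand F c on the left keeps the statement valid for n = 0. *)
Lemma sum_eigenvalues_scalar_const n (c t : algC) (F : algC -> algC) :
  \sum_(z <- eigenvalues (c%:M + const_mx t : 'M_n)) F z + F c =
  F c *+ n + F (c + t *+ n).
Proof.
rewrite -sum_nseq -[F c](big_seq1 +%R c F).
rewrite (@sum_eigenvalues _ _ _ (rcons (nseq n c) (c + t *+ n))).
  by rewrite big_rcons.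
rewrite -cats1 big_cat !big_seq1 prod_nseq /char_poly.
have -> : char_poly_mx (c%:M + const_mx t : 'M_n) =
    ('X - c%:P)%:M - const_mx t%:P *m (const_mx 1 : 'M_(1, n)).
  apply/matrixP=> i j; rewrite !mxE big_ord1 !mxE polyCD mulr1 opprD addrA.
  by case: eqP => _; rewrite ?mulr1n ?mulr0n ?polyC0 ?subr0.
have := det_scalar_sub_mulC ('X - c%:P)
  (const_mx t%:P : 'M_(n, 1)) (const_mx 1 : 'M_(1, n)).
rewrite expr1 => ->; congr (_ * _); rewrite det_mx11 !mxE eqxx mulr1n.
under eq_bigr do rewrite !mxE mul1r.
by rewrite sumr_const card_ord polyCD polyCMn opprD addrA.
Qed.

Lemma sum_eigenvalues_complete n (A : 'M_#|complete_graph n.+1|)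
    (c t : algC) (F : algC -> algC) :
  A = c%:M + const_mx t ->
  \sum_(z <- eigenvalues A) F z = F c *+ n + F (c + t *+ n.+1).
Proof.
move=> ->; apply: (addIr (F c)).
by rewrite sum_eigenvalues_scalar_const card_ord mulrSr addrAC.
Qed.

Lemma degree_complete n (x : complete_graph n.+1) : degree x = n.
Proof.
transitivity #|[set~ x]|; last by rewrite cardsC1 card_ord.
by apply: eq_card => y; rewrite !inE eq_sym.
Qed.

Lemma average_degree_complete n :
  average_degree (complete_graph n.+1) = n%:R.
Proof.
rewrite /average_degree.
have -> : edges (complete_graph n.+1) = [set A : {set 'I_n.+1} | #|A| == 2].
  apply/setP=> A; rewrite !inE.
  apply/existsP/cards2P => [[x /existsP[y /andP[xy /eqP ->]]]|[x [y [xy ->]]]].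
    by exists x, y.
  by exists x; apply/existsP; exists y; rewrite eqxx andbT.
rewrite card_draws card_ord -mul_bin_diag bin1 natrM mulrC mulKf //.
by rewrite pnatr_eq0.
Qed.

Lemma card_common_nbrs_complete n (x y : complete_graph n.+1) :
  x != y -> #|common_nbrs x y| = n.-1.
Proof.
move=> xy; transitivity #|~: [set x; y]|.
  apply: eq_card => z; rewrite !inE negb_or /=.
  by case: (z == x); case: (z == y).
by rewrite cardsCs setCK cards2 xy card_ord subn2.
Qed.

Lemma adj_mx_complete n :
  adj_mx (complete_graph n) = (-1)%:M + const_mx 1.
Proof.
apply/matrixP=> i j; rewrite !mxE /= (inj_eq enum_val_inj).
by case: eqP => _ /=; rewrite ?mulr1n ?mulr0n ?add0r ?addNr.
Qed.

Lemma degree_mx_complete n : degree_mx (complete_graph n.+1) = n%:R%:M.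
Proof.
by apply/matrixP=> i j; rewrite !mxE degree_complete.
Qed.

Lemma energy_complete n : energy (complete_graph n.+1) = (2 * n)%:R.
Proof.
rewrite /energy (sum_eigenvalues_complete _ (adj_mx_complete _)) normrN1.
have -> : -1 + 1 *+ n.+1 = n%:R :> algC by rewrite mulrSr addrC addrK.
by rewrite normr_nat -natrD addnn mul2n.
Qed.

Lemma laplacian_energy_complete n :
  laplacian_energy (complete_graph n.+1) = (2 * n)%:R.
Proof.
have eqL : degree_mx (complete_graph n.+1) - adj_mx (complete_graph n.+1) =
    n.+1%:R%:M + const_mx (-1).
  rewrite degree_mx_complete adj_mx_complete opprD addrA; congr (_ + _).
    by rewrite -[- (-1)%:M]raddfN opprK -raddfD natr1.
  by apply/matrixP=> i j; rewrite !mxE.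
rewrite /laplacian_energy average_degree_complete.
rewrite (sum_eigenvalues_complete _ eqL) mulNrn subrr add0r normrN normr_nat.
rewrite mulrSr (addrC _ 1) addrK normr1.
by rewrite -natrD addnn mul2n.
Qed.

Lemma signless_laplacian_energy_complete n :
  signless_laplacian_energy (complete_graph n.+1) = (2 * n)%:R.
Proof.
have eqQ : degree_mx (complete_graph n.+1) + adj_mx (complete_graph n.+1) =
    (n%:R - 1)%:M + const_mx 1.
  by rewrite degree_mx_complete adj_mx_complete addrA -raddfD.
rewrite /signless_laplacian_energy average_degree_complete.
rewrite (sum_eigenvalues_complete _ eqQ) (addrAC n%:R) subrr add0r normrN1.
have -> : n%:R - 1 + 1 *+ n.+1 - n%:R = n%:R :> algC by rewrite mulrSr; ring.
by rewrite normr_nat -natrD addnn mul2n.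
Qed.

Lemma cn_energy_complete n :
  cn_energy (complete_graph n.+1) = (2 * n * n.-1)%:R.
Proof.
have eqCN : cn_mx (complete_graph n.+1) = (- n.-1%:R)%:M + const_mx n.-1%:R.
  apply/matrixP=> i j; rewrite !mxE; case: eqVneq => [_|neq_ij].
    by rewrite mulr1n addNr.
  rewrite card_common_nbrs_complete ?mulr0n ?add0r //.
  by rewrite (inj_eq enum_val_inj).
rewrite /cn_energy (sum_eigenvalues_complete _ eqCN) normrN normr_nat.
have -> : - n.-1%:R + n.-1%:R *+ n.+1 = (n.-1 * n)%:R :> algC.
  by rewrite mulrSr addrC addrK natrM mulr_natr.
rewrite normr_nat -mulrnA -natrD; congr _%:R.
by rewrite mulnC addnn -mul2n mulnA mulnAC.
Qed.

End Complete.

(** * Numerical bounds *)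

Section Bounds.
Local Open Scope ring_scope.

(** Here a = 2m/(m + L) is the mean degree of a forest with L stars and m
    leaves.  If L <= m then a >= 1 and the left side is a (m + L) = 2m;
    otherwise a <= 1 and it is 2m + a (L - m) <= m + L. *)
Lemma mean_degree_bound (m L : nat) (a : algC) :
  (1 < L)%N -> a * (m + L)%:R = (2 * m)%:R ->
  `|1 - a| *+ m + a *+ L + m%:R <= (2 * (m + L).-1)%:R.
Proof.
move=> L_gt1 a_mL.
have mL_gt0 : 0 < (m + L)%:R :> algC by rewrite ltr0n; lia.
have a_ge0 : 0 <= a by rewrite -(pmulr_lge0 _ mL_gt0) a_mL ler0n.
have [L_le_m|m_lt_L] := leqP L m.
  have a_ge1 : 1 <= a.
    rewrite -(ler_pM2r mL_gt0) a_mL mul1r ler_nat mul2n -addnn.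
    by rewrite leq_add2l.
  rewrite distrC ger0_norm ?subr_ge0 //.
  have -> : (a - 1) *+ m + a *+ L + m%:R = (2 * m)%:R.
    by rewrite -a_mL natrD -(mulr_natr (a - 1)) -(mulr_natr a); ring.
  by rewrite ler_nat; lia.
have a_le1 : a <= 1.
  rewrite -(ler_pM2r mL_gt0) a_mL mul1r ler_nat mul2n -addnn.
  by rewrite leq_add2l ltnW.
rewrite ger0_norm ?subr_ge0 //.
have -> : (1 - a) *+ m + a *+ L + m%:R = (2 * m)%:R + a * (L - m)%:R.
  rewrite natrM natrB ?(ltnW m_lt_L) // -(mulr_natr (1 - a)) -(mulr_natr a).
  ring.
apply: (@le_trans _ _ (m + L)%:R).
  have -> : (m + L = 2 * m + (L - m))%N by lia.
  by rewrite natrD lerD2l ler_piMl.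
by rewrite ler_nat; lia.
Qed.

Lemma sqr_sqrtC_sub1 (x : algC) :
  (sqrtC x - 1) ^+ 2 = x + 1 - 2 * sqrtC x.
Proof. by rewrite -[x in x + 1]sqrtCK; ring. Qed.

Lemma double_sqrtC_le (x : algC) : 0 <= x -> 2 * sqrtC x <= x + 1.
Proof.
move=> x_ge0; rewrite -subr_ge0 -sqr_sqrtC_sub1.
by rewrite real_exprn_even_ge0 // rpredB ?rpred1 // ger0_real ?sqrtC_ge0.
Qed.

End Bounds.

(** * The subgroup generating graph as a forest of stars *)

Section GeneratingPairs.
Variable gT : finGroupType.
Local Open Scope ring_scope.

Local Notation B := (subgroup_generating_graph gT).

Definition generated_by (ab : gT * gT) : {group gT} :=
  <<[set ab.1; ab.2]>>%G.

Local Notation genpairs := (fibre_card generated_by).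

Lemma common_nbrsC (Gamma : sgraph) (x y : Gamma) :
  common_nbrs x y = common_nbrs y x.
Proof.
by apply/setP=> z; rewrite !inE andbCA; congr [&& _, _ & _]; rewrite andbC.
Qed.

Lemma sgb_adj_lr ab (H : {group gT}) :
  @adj B (inl ab) (inr H) = (generated_by ab == H).
Proof. by case: ab. Qed.

Lemma sgb_adj_rl ab (H : {group gT}) :
  @adj B (inr H) (inl ab) = (generated_by ab == H).
Proof. by case: ab. Qed.

Lemma sgb_adj_ll ab cd : @adj B (inl ab) (inl cd) = false.
Proof. by case: ab cd => [a b] []. Qed.

Lemma degree_pair ab : degree (inl ab : B) = 1%N.
Proof.
rewrite /degree -(cards1 (inr (generated_by ab) : B)).
apply: eq_card => -[cd|H]; rewrite !inE ?sgb_adj_ll // sgb_adj_lr eq_sym.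
by rewrite (inj_eq (@inr_inj _ _)).
Qed.

Lemma degree_subgroup H : degree (inr H : B) = genpairs H.
Proof.
have inl_injB : injective (inl : gT * gT -> B) by move=> ab cd [].
rewrite /degree /fibre_card -(card_imset _ inl_injB).
apply: eq_card => -[cd|K]; rewrite !inE ?sgb_adj_rl ?mem_imset ?inE //.
by symmetry; apply/imsetP => -[].
Qed.

(** Every edge has exactly one end among the pairs, and every pair lies on
    exactly one edge. *)
Lemma card_edges_sgb : #|edges B| = #|{: gT * gT}|.
Proof.
pose edge (ab : gT * gT) : {set B} := [set inl ab; inr (generated_by ab)].
have edge_inj : injective edge.
  move=> ab cd /setP/(_ (inl ab)); rewrite !inE eqxx /= orbF.
  by move/esym/eqP => [].
rewrite -(card_imset _ edge_inj); apply: eq_card => A; rewrite !inE.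
apply/existsP/imsetP => [[x /existsP[y /andP[]]]|[ab _ ->]]; last first.
  exists (inl ab); apply/existsP; exists (inr (generated_by ab)).
  by rewrite sgb_adj_lr !eqxx.
case: x y => [ab|H] [cd|K] //; first by rewrite sgb_adj_ll.
- by rewrite sgb_adj_lr => /eqP <- /eqP ->; exists ab.
- by rewrite sgb_adj_rl => /eqP <- /eqP ->; exists cd; rewrite // /edge setUC.
Qed.

Lemma card_common_nbrs_pairs ab cd :
  ab != cd ->
  #|common_nbrs (inl ab : B) (inl cd)| = (generated_by ab == generated_by cd).
Proof.
move=> neq; case: eqP => [eq_gen|neq_gen] /=.
  apply/eqP/cards1P; exists (inr (generated_by ab)); apply/setP => -[ef|H].
    by rewrite !inE sgb_adj_ll !andbF.
  rewrite !inE !sgb_adj_rl -eq_gen andbb eq_sym /=.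
  by rewrite (inj_eq (@inr_inj _ _)).
apply/eqP; rewrite cards_eq0; apply/eqP/setP => -[ef|H].
  by rewrite !inE sgb_adj_ll !andbF.
rewrite !inE !sgb_adj_rl /=; apply/andP => -[/eqP eq1 /eqP eq2].
by rewrite eq1 eq2 in neq_gen.
Qed.

Lemma common_nbrs_pair_subgroup ab H :
  common_nbrs (inl ab : B) (inr H) = set0.
Proof.
by apply/setP=> -[ef|K]; rewrite !inE ?sgb_adj_ll ?andbF.
Qed.

Lemma common_nbrs_subgroups H K :
  H != K -> common_nbrs (inr H : B) (inr K) = set0.
Proof.
move=> neq_HK; apply/setP=> -[ef|L]; last by rewrite !inE /= !andbF.
rewrite !inE !sgb_adj_lr /=; apply/andP => -[/eqP eq1 /eqP eq2].
by rewrite -eq1 -eq2 eqxx in neq_HK.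
Qed.

Local Notation m := #|{: gT * gT}|.
Local Notation L := #|{group gT}|.

Lemma card_sgb : #|B| = (m + L)%N.
Proof. exact: card_sum. Qed.

Lemma sum_genpairs : (\sum_H genpairs H = m)%N.
Proof. exact: sum_fibre_card. Qed.

(** * Spectra of the subgroup generating graph *)

Lemma energy_sgb : energy B = \sum_(H : {group gT}) 2 * sqrtC (genpairs H)%:R.
Proof.
have charA : char_poly (adj_mx B) * ('X - 0%:P) ^+ L = ('X - 0%:P) ^+ m *
   \prod_(H : {group gT}) (('X - (sqrtC (genpairs H)%:R)%:P) *
                           ('X - (- sqrtC (genpairs H)%:R)%:P)).
  rewrite (char_poly_star (f := generated_by) (c := 1) (e := fun=> 0)
    (F := fun u v : gT * gT + {group gT} => (@adj B u v)%:R)).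
  - congr (_ * _); apply: eq_bigr => H _; rewrite polyC0 subr0.
    rewrite polyCN opprK -[X in _ - X]polyC_natr.
    rewrite -[in LHS](sqrtCK (genpairs H)%:R) rmorphXn /=; ring.
  - by move=> ab cd; rewrite sgb_adj_ll mul0rn.
  - by move=> ab H; rewrite sgb_adj_lr.
  - by move=> ab H; rewrite sgb_adj_rl.
  - by move=> H K; rewrite mul0rn.
  - by rewrite expr1n.
have := sum_eigenvalues_quadratic Num.norm charA.
rewrite -/(energy _) normr0 !mul0rn addr0 add0r => ->.
apply: eq_bigr => H _; rewrite normrN -mulr2n mulr_natl ger0_norm //.
by rewrite sqrtC_ge0 ler0n.
Qed.

(** Taking c = -1 gives the Laplacian and c = 1 the signless Laplacian. *)
Lemma char_poly_laplacian_sgb (c : algC) :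
  c ^+ 2 = 1 ->
  char_poly (degree_mx B + c *: adj_mx B) * ('X - 1%:P) ^+ L =
  ('X - 1%:P) ^+ m *
    \prod_(H : {group gT}) (('X - 0%:P) * ('X - ((genpairs H).+1%:R)%:P)).
Proof.
move=> c2.
pose F (u v : gT * gT + {group gT}) : algC :=
  (@degree B u)%:R *+ (u == v) + c * (@adj B u v)%:R.
have -> : degree_mx B + c *: adj_mx B =
    \matrix_(i, j < #|{: gT * gT + {group gT}}|) F (enum_val i) (enum_val j).
  by apply/matrixP=> i j; rewrite !mxE /F (inj_eq enum_val_inj).
rewrite (char_poly_star (f := generated_by) (a := 1) (c := c)
  (e := fun H => (genpairs H)%:R)) /F //.
- congr (_ * _); apply: eq_bigr => H _.
  (* ('X - 1) * ('X - d) - d = 'X * ('X - (d + 1)) *)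
  rewrite -polyC_natr mulrSr polyCD; ring.
- move=> ab cd; rewrite sgb_adj_ll mulr0 addr0 degree_pair.
  by rewrite (inj_eq (@inl_inj _ _)).
- by move=> ab H; rewrite sgb_adj_lr mulr0n add0r mulr_natr.
- by move=> H ab; rewrite sgb_adj_rl mulr0n add0r mulr_natr.
- move=> H K; rewrite mulr0 addr0 degree_subgroup.
  by rewrite (inj_eq (@inr_inj _ _)).
Qed.

(** Two pairs share a neighbour exactly when they generate the same subgroup,
    and no other two vertices share one.  So the common neighbourhood matrix is
    I I^T - 1 on the pairs, for the incidence matrix I, and 0 elsewhere. *)
Lemma char_poly_cn_sgb :
  char_poly (cn_mx B) * ('X - (-1)%:P) ^+ L =
  ('X - (-1)%:P) ^+ m *
    \prod_(H : {group gT}) (('X - 0%:P) * ('X - ((genpairs H)%:R - 1)%:P)).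
Proof.
pose F (u v : gT * gT + {group gT}) : algC :=
  if u == v then 0 else #|@common_nbrs B u v|%:R.
have -> : cn_mx B =
    \matrix_(i, j < #|{: gT * gT + {group gT}}|) F (enum_val i) (enum_val j).
  by apply/matrixP=> i j; rewrite !mxE /F (inj_eq enum_val_inj).
set I := incidence_mx generated_by {poly algC}.
rewrite char_poly_sum_type.
set Q := \matrix_(i < #|{: gT * gT}|, j < #|{: gT * gT}|) _.
have -> : (\matrix_(i < #|{: gT * gT}|, j < #|{group gT}|)
   F (inl (enum_val i)) (inr (enum_val j))) = 0.
  by apply/matrixP=> i j; rewrite !mxE /F /= common_nbrs_pair_subgroup cards0.
have -> : (\matrix_(i < #|{group gT}|, j < #|{: gT * gT}|)
   F (inr (enum_val i)) (inl (enum_val j))) = 0.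
  apply/matrixP=> i j; rewrite !mxE /F /= common_nbrsC.
  by rewrite common_nbrs_pair_subgroup cards0.
have -> : (\matrix_(i < #|{group gT}|, j < #|{group gT}|)
   F (inr (enum_val i)) (inr (enum_val j))) = 0.
  apply/matrixP=> i j; rewrite !mxE /F (inj_eq (@inr_inj _ _)).
  by case: eqVneq => // neq; rewrite common_nbrs_subgroups ?cards0.
rewrite /char_poly char_block_diag_mx det_ublock.
rewrite [char_poly_mx 0]/char_poly_mx map_mx0 subr0 det_scalar.
have -> : char_poly_mx Q = ('X - (-1)%:P)%:M - I *m I^T.
  apply/matrixP=> i j; rewrite [LHS]mxE [RHS]mxE [X in _ = _ + X]mxE.
  rewrite incidence_mul_tr !mxE /F (inj_eq (@inl_inj _ _)).
  rewrite (inj_eq enum_val_inj); case: eqVneq => [->|neq_ij].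
    by rewrite eqxx /= !mulr1n polyC0 polyCN polyC1; ring.
  rewrite card_common_nbrs_pairs ?(inj_eq enum_val_inj) // !mulr0n.
  by rewrite polyC_natr.
rewrite mulrAC det_scalar_sub_mulC incidence_gram -mulrA; congr (_ * _).
rewrite -diag_const_mx -linearB /= det_diag.
rewrite [X in _ = X](reindex _ (onW_bij _ (enum_val_bij {group gT}))) /=.
rewrite big_split /= mulrC polyC0 subr0; congr (_ * _).
  by rewrite prodr_const card_ord.
apply: eq_bigr => i _; rewrite !mxE polyCB polyC_natr polyCN; ring.
Qed.

(** * Energy bounds for nontrivial groups *)

Hypothesis gT_gt1 : (1 < #|gT|)%N.

Lemma card_groups_gt1 : (1 < L)%N.
Proof.
have <- : #|[set 1%G; [set: gT]%G]| = 2%N.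
  rewrite cards2; case: eqP => // /(congr1 (fun H : {group gT} => #|H|)).
  by rewrite /= cards1 cardsT => eq1; move: gT_gt1; rewrite -eq1.
exact: max_card.
Qed.

(** Swapping the two generators yields a second generating pair. *)
Lemma exists_genpairs_gt1 : exists H : {group gT}, (1 < genpairs H)%N.
Proof.
have /card_gt1P[a [b [_ _ neq_ab]]] := gT_gt1.
exists (generated_by (a, b)).
rewrite /fibre_card; apply/card_gt1P; exists (a, b), (b, a).
rewrite !inE eqxx xpair_eqE negb_and neq_ab /generated_by /=; split=> //.
by rewrite setUC.
Qed.

Lemma sum_genpairsD1 :
  \sum_(H : {group gT}) ((genpairs H)%:R + 1) = (m + L)%:R :> algC.
Proof.
by rewrite big_split /= -natr_sum sum_genpairs sumr_const natrD.
Qed.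

(** Termwise 2 sqrt(d) <= d + 1, with strict inequality for d > 1. *)
Lemma energy_sgb_lt : energy B < (m + L)%:R.
Proof.
have [H1 H1_gt1] := exists_genpairs_gt1.
rewrite energy_sgb -sum_genpairsD1 (bigD1 H1) // [ltRHS](bigD1 H1) //=.
apply: ltr_leD; last by apply: ler_sum => H _; exact: double_sqrtC_le.
rewrite lt_neqAle double_sqrtC_le // andbT; apply/negP => /eqP eq1.
have /eqP := sqr_sqrtC_sub1 (genpairs H1)%:R; rewrite eq1 subrr.
rewrite sqrf_eq0 subr_eq0 => /eqP sqrt1.
have /eqP := sqrtCK ((genpairs H1)%:R : algC).
by rewrite sqrt1 expr1n eq_sym pnatr_eq1 => /eqP d1; rewrite d1 in H1_gt1.
Qed.

(** The triangle inequality |d + 1 - a| <= d + |1 - a| makes the eigenvalues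
    d + 1 absorb the surplus of eigenvalues 1, and leaves a bound that no longer
    depends on the single fibre sizes. *)
Lemma laplacian_sum_le (c : algC) :
  c ^+ 2 = 1 ->
  \sum_(z <- eigenvalues (degree_mx B + c *: adj_mx B))
    `|z - average_degree B| <= (2 * (m + L).-1)%:R.
Proof.
move=> c2.
set a := average_degree B.
have L_gt1 := card_groups_gt1.
have mL_gt0 : 0 < (m + L)%:R :> algC by rewrite ltr0n; lia.
have a_mL : a * (m + L)%:R = (2 * m)%:R.
  by rewrite /a /average_degree card_edges_sgb card_sgb divfK // gt_eqF.
have a_ge0 : 0 <= a.
  by rewrite -(pmulr_lge0 _ mL_gt0) a_mL ler0n.
have := sum_eigenvalues_quadratic (fun z => `|z - a|)
  (char_poly_laplacian_sgb c2).
set Sigma := \sum_(z <- _) _ => eqSigma.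
have leSigma : Sigma <= `|1 - a| *+ m + a *+ L + m%:R.
  rewrite -(lerD2r (`|1 - a| *+ L)) eqSigma -!addrA lerD2l.
  rewrite big_split /= sub0r normrN ger0_norm // sumr_const lerD2l.
  rewrite -sum_genpairs natr_sum -sumr_const -big_split /=.
  apply: ler_sum => H _; rewrite mulrSr -addrA.
  by rewrite (le_trans (ler_normD _ _)) // normr_nat.
apply: (le_trans leSigma).
exact: mean_degree_bound.
Qed.

Lemma cn_energy_sgb_le : cn_energy B <= (2 * m)%:R.
Proof.
have := sum_eigenvalues_quadratic Num.norm char_poly_cn_sgb.
rewrite -/(cn_energy _) normrN1 normr0 => eqE.
rewrite -(lerD2r L%:R) eqE mul2n -addnn natrD -addrA lerD2l.
rewrite -sum_genpairs natr_sum -sumr_const -big_split /=.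
apply: ler_sum => H _; rewrite add0r.
by rewrite (le_trans (ler_normD _ _)) // normr_nat normrN1.
Qed.

Lemma sgb_energies :
  hypoenergetic B /\ ~ hyperenergetic B /\ ~ L_hyperenergetic B /\
  ~ Q_hyperenergetic B /\ ~ CN_hyperenergetic B.
Proof.
have L_gt1 := card_groups_gt1.
have m_gt0 : (0 < m)%N by rewrite card_prod muln_gt0 (ltnW gT_gt1).
have predN : #|B| = (m + L).-1.+1.
  by rewrite card_sgb prednK // addn_gt0 m_gt0.
have n_le : (m + L <= 2 * (m + L).-1)%N by lia.
rewrite /hypoenergetic /hyperenergetic /L_hyperenergetic /Q_hyperenergetic.
rewrite /CN_hyperenergetic predN energy_complete laplacian_energy_complete.
rewrite signless_laplacian_energy_complete cn_energy_complete.
split; first by rewrite prednK ?ltn_addr // energy_sgb_lt.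
split; first by move/lt_trans/(_ energy_sgb_lt); rewrite ltr_nat ltnNge n_le.
have n1 : (-1) ^+ 2 = 1 :> algC by rewrite sqrrN expr1n.
have c1 : 1 ^+ 2 = 1 :> algC by rewrite expr1n.
have := laplacian_sum_le n1; rewrite scaleN1r => leL.
have := laplacian_sum_le c1; rewrite scale1r => leQ.
split; first by move/(le_lt_trans leL); rewrite ltxx.
split; first by move/(le_lt_trans leQ); rewrite ltxx.
move/lt_le_trans/(_ cn_energy_sgb_le).
rewrite ltr_nat ltnNge -mulnA leq_mul2l /=.
(* With L = l + 2 the claim becomes m <= (m + l).+1 * (m + l). *)
rewrite -(subnKC L_gt1) add2n !addnS /= => /negP; apply.
by apply: leq_trans (leq_pmull _ _) => //; exact: leq_addr.
Qed.

End GeneratingPairs.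

Theorem theorem3p6 (p : nat) (p_prime : prime p) (gT : finGroupType)
    (gT_dihedral : [set: gT] \isog [set: 'D_(2 * p ^ 2)]) :
  hypoenergetic (subgroup_generating_graph gT) /\
  ~ hyperenergetic (subgroup_generating_graph gT) /\
  ~ L_hyperenergetic (subgroup_generating_graph gT) /\
  ~ Q_hyperenergetic (subgroup_generating_graph gT) /\
  ~ CN_hyperenergetic (subgroup_generating_graph gT).
Proof.
apply: sgb_energies; rewrite -cardsT (card_isog gT_dihedral).
have p2_gt1 : 1 < p ^ 2 by rewrite (ltn_exp2l 0) ?prime_gt1.
by rewrite mul2n card_dihedral // -muln2 (leq_trans p2_gt1) ?leq_pmulr.
Qed.
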